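(* For every integer $d\geq 2$ there exists a Lebesgue measurable set $E\subseteq \mathbb{R}^d$ with $\delta(E)>0$ such that for all $x\in E$ and all $l>0$ there exists $l'>l$ such that $$|x-y|\neq l' \quad \text{for all } y\in E.$$
   Context: For a Lebesgue measurable set $A\subseteq\mathbb{R}^d$, the upper density is $\delta(A):=\limsup_{R\to\infty}\frac{|B(0,R)\cap A|}{R^d}$, where $B(0,R)$ is the Euclidean ball of radius $R$ centered at the origin and $|\cdot|$ of a set denotes $d$-dimensional Lebesgue measure (note the normalization by $R^d$ rather than $|B(0,R)|$). For points $x,y\in\mathbb{R}^d$, $|x-y|$ denotes Euclidean distance. *)

(* Defs.v *)
From HB Require Import structures.
From mathcomp Require Import all_boot all_order all_algebra.
From mathcomp Require Import all_classical all_reals all_analysis.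

Set Implicit Arguments.
Unset Strict Implicit.
Unset Printing Implicit Defensive.
Import Order.TTheory GRing.Theory Num.Theory.
Import numFieldNormedType.Exports.

Local Open Scope classical_set_scope.
Local Open Scope ring_scope.

(* The library norm on ['rV[R]_d] is the sup norm, hence the explicit
   Euclidean norm. *)
Definition enorm {R : realType} {d : nat} (v : 'rV[R]_d) : R :=
  Num.sqrt (\sum_(i < d) v ord0 i ^+ 2).

Definition eball {R : realType} {d : nat} (c : 'rV[R]_d) (r : R)
    : set 'rV[R]_d :=
  [set x | enorm (x - c) < r].

Definition box {R : realType} {d : nat} (a b : 'rV[R]_d) : set 'rV[R]_d :=
  [set x | forall i : 'I_d, a ord0 i < x ord0 i <= b ord0 i].

(* [box a b] is empty as soon as [b ord0 i <= a ord0 i] for some [i]. *)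
Definition box_volume {R : realType} {d : nat} (a b : 'rV[R]_d) : R :=
  \prod_(i < d) Num.max 0 (b ord0 i - a ord0 i).

(* [d]-dimensional Lebesgue outer measure, for [0 < d]: for [d = 0] no box is
   empty, so covers by full sequences of boxes give [set0] infinite measure. *)
Definition lebesgue_outer {R : realType} {d : nat} (A : set 'rV[R]_d)
    : \bar R :=
  ereal_inf [set (\sum_(k <oo) (box_volume (c k).1 (c k).2)%:E)%E
    | c in [set c : nat -> 'rV[R]_d * 'rV[R]_d |
             A `<=` \bigcup_k box (c k).1 (c k).2]].

Definition lebesgue_measurable {R : realType} {d : nat} (A : set 'rV[R]_d)
    : Prop :=
  (@lebesgue_outer R d).-caratheodory A.

(* On measurable sets the Lebesgue measure is [lebesgue_outer].  The density is
   normalised by [r ^+ d], not by the volume of the ball. *)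
Definition upper_density {R : realType} {d : nat} (A : set 'rV[R]_d)
    : \bar R :=
  limf_esup (fun r : R => lebesgue_outer (eball 0 r `&` A) * (r ^- d)%:E)%E
    (pinfty_nbhs R).

(* Main.v *)
Require Import Defs.
From HB Require Import structures.
From mathcomp Require Import all_boot all_order all_algebra.
From mathcomp Require Import all_classical all_reals all_analysis.
From mathcomp Require Import measurable_realfun lra.

Set Implicit Arguments.
Unset Strict Implicit.
Unset Printing Implicit Defensive.
Import Order.TTheory GRing.Theory Num.Theory.
Import numFieldNormedType.Exports.

Local Open Scope classical_set_scope.
Local Open Scope ring_scope.

(** Take the union of the cubes ]s_n, 2 s_n]^d with s_n = (4 d)^n.  Seen from a
fixed point x, the distance l' = 3 d s_n falls into a gap once s_n > |x|.  The
points of the cubes up to the n-th have coordinates at most 2 s_n, so they are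
at distance at most d (|x| + 2 s_n) < l' from x; those of the later cubes have
coordinates larger than s_(n+1) = 4 d s_n, so they are at distance more than
4 d s_n - |x| > l'.  Hence x misses arbitrarily large distances
([far_cubes_missed_distance]).  The gaps do not hurt the upper density, which
only looks at a sequence of radii: the ball of radius 3 d s_n contains the
whole n-th cube, whose volume s_n^d is a fraction (3 d)^-d of the d-th power of
the radius ([far_cubes_density]).

What remains is measure theory for the outer measure given by covers by boxes.
It is countably subadditive, and half-spaces satisfy the Caratheodory criterion
because a hyperplane cuts a box into two boxes with the same total volume; so
boxes and their countable unions are measurable ([box_measurable]).  The
density bound needs that a box has outer measure at least its volume, i.e. that
countably many boxes covering it have total volume at least its own
([box_cover_volume]).  This goes by induction on the dimension: apply the case
of one dimension less to each slice orthogonal to the last axis, then integrate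
over the last coordinate with the one-dimensional Lebesgue integral, which
commutes with countable sums of nonnegative functions. *)

(** * Covers of a box by countably many boxes *)

Lemma integral_indic_itv_oc (R : realType) (a b : R) :
  (\int[lebesgue_measure]_t (\1_(`]a, b]) t)%:E =
   (Num.max 0 (b - a))%:E :> \bar R)%E.
Proof.
rewrite integral_indic// setIT [LHS]lebesgue_measure_itv /= lte_fin.
by case: ltP => ab; rewrite -?EFinB; congr EFin;
  [rewrite max_r // subr_ge0 ltW | rewrite max_l // subr_le0].
Qed.

(** The weights [w] make the induction on the dimension go through: slicing at
height [t] keeps the boxes whose last side contains [t], which amounts to
multiplying the [k]-th weight by the indicator of that side.  Points and corners
are functions on [nat], of which only the first [n] values matter, so that the
boxes of a slice have the same type as the boxes themselves. *)
Lemma box_cover_volume (R : realType) n (a b : nat -> R) (l r : nat -> nat -> R)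
    (w : nat -> R) : (forall k, 0 <= w k) ->
  (forall x : nat -> R, (forall i, (i < n)%N -> a i < x i <= b i) ->
    (1 <= \sum_(k <oo)
            (w k * \prod_(i < n) \1_(`]l k i, r k i]) (x i))%:E)%E) ->
  ((\prod_(i < n) Num.max 0 (b i - a i))%:E <=
   \sum_(k <oo) (w k * \prod_(i < n) Num.max 0 (r k i - l k i))%:E)%E.
Proof.
have pr_ge0 m (c e : nat -> R) : 0 <= \prod_(i < m) Num.max 0 (e i - c i).
  by apply: prodr_ge0 => i _; rewrite le_max lexx.
elim: n w => [|n IH] w w0 cov.
  rewrite big_ord0; apply: le_trans (cov (fun=> 0) _) _ => //.
  apply: lee_nneseries => [k _ _|k _]; rewrite lee_fin !big_ord0 ?mulr1//.
have slice t :
  ((\prod_(i < n) Num.max 0 (b i - a i))%:E * (\1_(`]a n, b n]) t)%:E <=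
   \sum_(k <oo) (w k * \prod_(i < n) Num.max 0 (r k i - l k i))%:E *
     (\1_(`]l k n, r k n]) t)%:E)%E.
  rewrite indicE; case: (boolP (t \in _)); last first.
    by move=> _; rewrite mule0; apply: nneseries_ge0 => k _ _;
       rewrite -EFinM lee_fin !mulr_ge0.
  rewrite inE /= in_itv /= => tab; rewrite mule1.
  apply: le_trans (IH (fun k => w k * \1_(`]l k n, r k n]) t) _ _) _.
  - by move=> k; rewrite mulr_ge0.
  - move=> x xab.
    (* the point of the box above [x] at height [t] *)
    have := cov (fun i => if i == n then t else x i).
    have -> : (\sum_(k <oo) (w k * \prod_(i < n.+1)
         \1_(`]l k i, r k i]) (if (i : nat) == n then t else x i))%:E =
       \sum_(k <oo) (w k * \1_(`]l k n, r k n]) t *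
         \prod_(i < n) \1_(`]l k i, r k i]) (x i))%:E :> \bar R)%E.
      apply: eq_eseriesr => k _; congr EFin.
      rewrite big_ord_recr /= eqxx mulrA mulrAC; congr (_ * _).
      by apply: eq_bigr => i _; rewrite ltn_eqF.
    apply=> i; rewrite ltnS leq_eqVlt => /orP[/eqP ->|lt_in].
      by rewrite eqxx.
    by rewrite ltn_eqF // xab.
  - apply: lee_nneseries => [k _ _|k _]; first by rewrite lee_fin !mulr_ge0.
    by rewrite -EFinM lee_fin mulrAC.
have mI c e : measurable_fun [set: R] (EFin \o (\1_(`]c, e]) : R -> R)).
  by apply/measurable_EFinP; exact: measurable_indic.
have summand_ge0 k t : (0 <=
    (w k * \prod_(i < n) Num.max 0 (r k i - l k i))%:E *
    (\1_(`]l k n, r k n]) t)%:E)%E by rewrite -EFinM lee_fin !mulr_ge0.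
have summand_mfun k : measurable_fun [set: R] ((fun t : R =>
    (w k * \prod_(i < n) Num.max 0 (r k i - l k i))%:E *
    (\1_(`]l k n, r k n]) t)%:E)%E : R -> \bar R).
  by apply: measurable_funeM; exact: mI.
have -> : ((\prod_(i < n.+1) Num.max 0 (b i - a i))%:E =
    \int[lebesgue_measure]_t ((\prod_(i < n) Num.max 0 (b i - a i))%:E *
    (\1_(`]a n, b n]) t)%:E))%E.
  rewrite ge0_integralZl_EFin//=; [|exact: mI|exact: pr_ge0].
  by rewrite integral_indic_itv_oc big_ord_recr.
rewrite [leRHS](_ : _ = (\int[lebesgue_measure]_t \sum_(k <oo)
     ((w k * \prod_(i < n) Num.max 0 (r k i - l k i))%:E *
     (\1_(`]l k n, r k n]) t)%:E))%E); last first.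
  rewrite integral_nneseries//=; apply: eq_eseriesr => k _.
  rewrite ge0_integralZl_EFin//=;
    [|exact: mI|exact: mulr_ge0 (w0 k) (pr_ge0 _ _ _)].
  rewrite integral_indic_itv_oc.
  by rewrite big_ord_recr /= mulrA.
apply: ge0_le_integral => //.
- by move=> t _; rewrite -EFinM lee_fin mulr_ge0.
- by apply: measurable_funeM; exact: mI.
- apply: ge0_emeasurable_sum => [k t _ _|k _].
    exact: summand_ge0.
  exact: summand_mfun.
Qed.

(** * The outer measure defined by covers by boxes *)

Section outer.
Variable R : realType.
Implicit Type d : nat.

Lemma box_volume_ge0 d (a b : 'rV[R]_d) : 0 <= box_volume a b.
Proof. by apply: prodr_ge0 => i _; rewrite le_max lexx. Qed.

Lemma lebesgue_outer_cover d (A : set 'rV[R]_d)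
    (c : nat -> 'rV[R]_d * 'rV[R]_d) :
  A `<=` \bigcup_k box (c k).1 (c k).2 ->
  (lebesgue_outer A <= \sum_(k <oo) (box_volume (c k).1 (c k).2)%:E)%E.
Proof. by move=> Ac; apply: ereal_inf_lbound; exists c. Qed.

Lemma lebesgue_outer_ge0 d (A : set 'rV[R]_d) : (0 <= lebesgue_outer A)%E.
Proof.
apply: le_ereal_inf_tmp => _ [c _ <-]; apply: nneseries_ge0 => k _ _.
by rewrite lee_fin box_volume_ge0.
Qed.

Lemma le_lebesgue_outer d :
  {homo @lebesgue_outer R d : A B / A `<=` B >-> (A <= B)%E}.
Proof.
move=> A B AB; apply: le_ereal_inf_tmp => _ [c Bc <-].
by apply: lebesgue_outer_cover => x /AB; exact: Bc.
Qed.

(** Positive dimension is required: in dimension 0 every box has volume 1. *)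
Lemma lebesgue_outer_set0 d : lebesgue_outer (set0 : set 'rV[R]_d.+1) = 0%E.
Proof.
apply/eqP; rewrite eq_le lebesgue_outer_ge0 andbT.
apply: le_trans (@lebesgue_outer_cover _ _ (fun=> (0, 0)) _) _ => //.
rewrite eseries0// => k _ _ /=.
by rewrite /box_volume big_ord_recl !mxE subrr maxxx mul0r.
Qed.

Lemma lebesgue_outer_adherent d (A : set 'rV[R]_d) (e : R) : 0 < e ->
  lebesgue_outer A \is a fin_num ->
  exists2 c : nat -> 'rV[R]_d * 'rV[R]_d,
    A `<=` \bigcup_k box (c k).1 (c k).2 &
    (\sum_(k <oo) (box_volume (c k).1 (c k).2)%:E <= lebesgue_outer A + e%:E)%E.
Proof.
move=> e0 /(lb_ereal_inf_adherent e0)[_ [c Ac <-]] /ltW.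
by exists c.
Qed.

(** Near-optimal covers of the sets, with errors adding up to [e], merge into
one cover of the union, indexed by [nat * nat] and renumbered through a
bijection with [nat]. *)
Lemma lebesgue_outer_sigma_subadditive d :
  sigma_subadditive (@lebesgue_outer R d).
Proof.
move=> A; have [[i Ai]|] := pselect (exists i, lebesgue_outer (A i) = +oo%E).
  rewrite (eseries_pinfty _ _ Ai) ?leey// => n _.
  by rewrite -ltNye (lt_le_trans _ (lebesgue_outer_ge0 _)).
move/forallNP => Afin.
apply/lee_addgt0Pr => e e0.
apply: le_trans (epsilon_trick _ _ (ltW e0)); last first.
  by move=> n; exact: lebesgue_outer_ge0.
have /choice[c Pc] n : exists c : nat -> 'rV[R]_d * 'rV[R]_d,
    A n `<=` \bigcup_k box (c k).1 (c k).2 /\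
    (\sum_(k <oo) (box_volume (c k).1 (c k).2)%:E <=
       lebesgue_outer (A n) + (e / (2 ^ n.+1)%:R)%:E)%E.
  have e2 : 0 < e / (2 ^ n.+1)%:R by rewrite divr_gt0// ltr0n expn_gt0.
  have [|c] := lebesgue_outer_adherent e2 (A := A n).
    by rewrite ge0_fin_numE ?lebesgue_outer_ge0// ltey; exact/eqP/Afin.
  by exists c.
have /card_esym/ppcard_eqP[f] := card_nat2.
pose vol p := (box_volume (c p.1 p.2).1 (c p.1 p.2).2)%:E.
have vol0 p : (0 <= vol p)%E by rewrite lee_fin box_volume_ge0.
apply: le_trans (lebesgue_outer_cover (c := fun k => c (f k).1 (f k).2) _) _.
  move=> x [n _ /(Pc n).1[k _ xk]]; exists (f^-1%FUN (n, k)) => //=.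
  by rewrite invK ?inE.
rewrite (nneseries_esumT (fun k => vol0 (f k))).
rewrite -(reindex_esum setT setT f vol)//.
have -> : [set: nat * nat] = setT `*`` (fun=> setT) by apply/seteqP; split.
rewrite -(esum_esum (a := fun i j => vol (i, j)))//.
rewrite -nneseries_esumT; last by move=> n; exact: esum_ge0.
apply: lee_nneseries => [n _ _|n _]; first exact: esum_ge0.
by rewrite -nneseries_esumT//; exact: (Pc n).2.
Qed.

HB.instance Definition _ d := isOuterMeasure.Build R _ (@lebesgue_outer R d.+1)
  (lebesgue_outer_set0 d) (@lebesgue_outer_ge0 d.+1) (@le_lebesgue_outer d.+1)
  (@lebesgue_outer_sigma_subadditive d.+1).

(** The half of [volume = outer measure] that does not follow from covering the
box by itself: it is [box_cover_volume] with unit weights, since in a cover the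
indicators of the boxes add up to at least 1 on the covered box. *)
Lemma lebesgue_outer_box_ge d (a b : 'rV[R]_d.+1) :
  ((box_volume a b)%:E <= lebesgue_outer (box a b))%E.
Proof.
apply: le_ereal_inf_tmp => _ [c cov <-].
have volE (u v : 'rV[R]_d.+1) : box_volume u v = \prod_(i < d.+1)
    Num.max 0 (v ord0 (inord i) - u ord0 (inord i)).
  by apply: eq_bigr => i _; rewrite inord_val.
rewrite volE.
apply: le_trans (box_cover_volume (a := fun i => a ord0 (inord i))
  (b := fun i => b ord0 (inord i)) (w := fun=> 1)
  (l := fun k i => (c k).1 ord0 (inord i))
  (r := fun k i => (c k).2 ord0 (inord i)) _ _) _ => //.
  move=> x xab.
  have /cov[k _ xk] : box a b (\row_i x i).
    by move=> i; have := xab i (ltn_ord i); rewrite inord_val mxE.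
  have indic_ge0 j : (0 <= (1 * \prod_(i < d.+1)
      \1_(`](c j).1 ord0 (inord i), (c j).2 ord0 (inord i)]) (x i))%:E
      :> \bar R)%E.
    by rewrite lee_fin mul1r prodr_ge0.
  rewrite (nneseriesD1 (n := k))// big1 ?mulr1; last first.
    move=> i _; rewrite indicE mem_set//= in_itv/= inord_val.
    by have := xk i; rewrite mxE.
  by rewrite leeDl// nneseries_ge0.
apply: lee_nneseries => [k _ _|k _].
  by rewrite lee_fin mul1r prodr_ge0// => i _; rewrite le_max lexx.
by rewrite mul1r volE.
Qed.

(** * Boxes are measurable *)

(** Cutting ]a, b] at [t] preserves the total length, including when [t] falls
outside the interval or the interval is empty. *)
Lemma clip_interval (a b t : R) : Num.max 0 (b - a) =
  Num.max 0 (b - Num.max a t) + Num.max 0 (Num.min b t - a).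
Proof.
case: (leP a t) => at_; case: (leP b t) => bt; case: (leP 0 (b - a)) => ?;
  case: (leP 0 (b - t)) => ?; case: (leP 0 (t - a)) => ?; lra.
Qed.

(** The hyperplane cuts each box of a cover into a box on either side; this
turns a cover of a set into covers of its two parts with the same total
volume. *)
Lemma halfspace_measurable d (i : 'I_d.+1) (t : R) :
  lebesgue_measurable [set x : 'rV[R]_d.+1 | t < x ord0 i].
Proof.
apply: le_caratheodory_measurable => X.
apply: le_ereal_inf_tmp => _ [c Xc <-].
pose up (a : 'rV[R]_d.+1) : 'rV[R]_d.+1 :=
  \row_j if j == i then Num.max (a ord0 j) t else a ord0 j.
pose dn (b : 'rV[R]_d.+1) : 'rV[R]_d.+1 :=
  \row_j if j == i then Num.min (b ord0 j) t else b ord0 j.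
have volD1 (a b : 'rV[R]_d.+1) : box_volume a b =
    Num.max 0 (b ord0 i - a ord0 i) *
    \prod_(j < d.+1 | j != i) Num.max 0 (b ord0 j - a ord0 j).
  by rewrite /box_volume (bigD1 i).
have -> : (\sum_(k <oo) (box_volume (c k).1 (c k).2)%:E =
    \sum_(k <oo) (box_volume (up (c k).1) (c k).2)%:E +
    \sum_(k <oo) (box_volume (c k).1 (dn (c k).2))%:E)%E.
  rewrite -nneseriesD; try by move=> k _ _; rewrite lee_fin box_volume_ge0.
  apply: eq_eseriesr => k _; rewrite -EFinD; congr EFin.
  rewrite !volD1 !mxE eqxx (clip_interval _ _ t) mulrDl.
  by congr (_ * _ + _ * _); apply: eq_bigr => j /negPf ji; rewrite !mxE ji.
apply: leeD.
  apply: (lebesgue_outer_cover (c := fun k => (up (c k).1, (c k).2))).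
  move=> x [/Xc[k _ xk]] /= tx; exists k => // j /=.
  by rewrite mxE; case: eqVneq => [->|_]; rewrite ?gt_max ?tx ?andbT; exact: xk.
apply: (lebesgue_outer_cover (c := fun k => ((c k).1, dn (c k).2))).
move=> x [/Xc[k _ xk]] /= /negP; rewrite -leNgt => tx; exists k => // j /=.
by rewrite mxE; case: eqVneq => [->|_]; rewrite ?le_min ?tx ?andbT; exact: xk.
Qed.

Lemma box_measurable d (a b : 'rV[R]_d.+1) : lebesgue_measurable (box a b).
Proof.
(* [inord n] ranges over all coordinates as [n] ranges over [nat], which makes
   the box a countable intersection *)
pose slab n : set 'rV[R]_d.+1 :=
  [set x | a ord0 (inord n) < x ord0 (inord n)] `&`
  ~` [set x | b ord0 (inord n) < x ord0 (inord n)].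
have -> : box a b = ~` (\bigcup_n ~` slab n).
  rewrite setC_bigcup; apply/seteqP; split => x xab.
    move=> n _; rewrite setCK; have /andP[? ?] := xab (inord n).
    by split => //=; apply/negP; rewrite -leNgt.
  move=> i; have := xab i I; rewrite setCK /slab /= inord_val => -[-> /negP].
  by rewrite -leNgt.
apply: caratheodory_measurable_setC; apply: caratheodory_measurable_bigcup => n.
apply: caratheodory_measurable_setC; apply: caratheodory_measurable_setI.
  exact: halfspace_measurable.
by apply: caratheodory_measurable_setC; exact: halfspace_measurable.
Qed.

(** * Euclidean norm and upper density *)

Lemma ler_coord_enorm d (v : 'rV[R]_d) i : `|v ord0 i| <= enorm v.
Proof.
rewrite -sqrtr_sqr ler_wsqrtr// (bigD1 i)//= lerDl.
by apply: sumr_ge0 => j _; exact: sqr_ge0.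
Qed.

(** The crude factor [d.+1], instead of its square root, keeps the bounds below
polynomial. *)
Lemma enorm_le_coord d (v : 'rV[R]_d.+1) (M : R) :
  (forall i, `|v ord0 i| <= M) -> enorm v <= d.+1%:R * M.
Proof.
move=> vM; have M0 : 0 <= M by apply: le_trans (vM ord0).
have DM0 : 0 <= d.+1%:R * M by rewrite mulr_ge0.
rewrite -(ger0_norm DM0) -sqrtr_sqr ler_wsqrtr//.
apply: (@le_trans _ _ (\sum_(i < d.+1) M ^+ 2)).
  apply: ler_sum => i _.
  by rewrite -real_normK ?num_real// lerXn2r// nnegrE.
rewrite sumr_const card_ord exprMn -[leLHS]mulr_natl ler_wpM2r ?sqr_ge0//.
by rewrite -natrX ler_nat -mulnn leq_pmulr.
Qed.

Lemma upper_density_ge d (A : set 'rV[R]_d) (l : \bar R) :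
  (forall M : R, exists2 r : R, M < r &
    (l <= lebesgue_outer (eball 0 r `&` A) * (r ^- d)%:E)%E) ->
  (l <= upper_density A)%E.
Proof.
move=> lA; apply: le_ereal_inf_tmp => _ [V [M [_ MV]] <-].
have [r Mr /le_trans] := lA M; apply; apply: ereal_sup_ubound.
by exists r => //; exact: MV.
Qed.

End outer.

(** * A union of cubes escaping to infinity at a geometric rate *)

Section cubes.
Variable R : realType.

(** The ratio [4 * d.+1] leaves room for the distance [3 * d.+1%:R * scale d n]
strictly between the distances to the cubes up to the [n]-th and those to the
later ones, from any point close enough to the origin. *)
Definition scale d n : R := ((4 * d.+1) ^ n)%:R.

Definition far_cube d n : set 'rV[R]_d.+1 :=
  box (const_mx (scale d n)) (const_mx (2 * scale d n)).
Arguments far_cube d n : clear implicits.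

Definition far_cubes d : set 'rV[R]_d.+1 := \bigcup_n far_cube d n.
Arguments far_cubes d : clear implicits.

Lemma scale_ge1 d n : 1 <= scale d n.
Proof. by rewrite ler1n expn_gt0. Qed.

Lemma scale_unbounded d (M : R) : exists n, M < scale d n.
Proof.
have [M0|M0] := leP M 0.
  by exists 0%N; apply: le_lt_trans M0 _; rewrite ltr0n.
exists (Num.bound M); apply: lt_trans (archi_boundP (ltW M0)) _.
by rewrite ltr_nat ltn_expl// mulnS.
Qed.

Lemma scaleS d n : scale d n.+1 = 4 * d.+1%:R * scale d n.
Proof. by rewrite /scale expnS !natrM. Qed.

Lemma le_scale d : {homo scale d : m n / (m <= n)%N >-> m <= n}.
Proof. by move=> m n mn; rewrite ler_nat leq_pexp2l. Qed.

Lemma far_cube_coord d n (y : 'rV[R]_d.+1) i : far_cube d n y ->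
  scale d n < y ord0 i <= 2 * scale d n.
Proof. by move=> /(_ i); rewrite !mxE. Qed.

Lemma far_cubes_density d : (0 < upper_density (far_cubes d))%E.
Proof.
have D0 : 0 < d.+1%:R :> R by rewrite ltr0n.
(* the share of the [n]-th cube in the [d.+1]-th power of the radius, for each
   [n] *)
pose c : R := (3 * d.+1%:R) ^- d.+1.
have c0 : 0 < c by rewrite invr_gt0 exprn_gt0// mulr_gt0.
apply: (@lt_le_trans _ _ c%:E); first by rewrite lte_fin.
apply: upper_density_ge => M; have [n Mn] := scale_unbounded d `|M|.
have s1 := scale_ge1 d n; have D1 : 1 <= d.+1%:R :> R by rewrite ler1n.
exists (3 * d.+1%:R * scale d n).
  by apply: le_lt_trans (ler_norm M) _; nra.
have rn0 : 0 <= (3 * d.+1%:R * scale d n) ^- d.+1.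
  by rewrite invr_ge0 exprn_ge0// !mulr_ge0// ltW.
apply: (@le_trans _ _ ((scale d n ^+ d.+1)%:E *
    ((3 * d.+1%:R * scale d n) ^- d.+1)%:E)%E).
  rewrite -EFinM lee_fin exprMn invfM mulrCA divff ?mulr1//.
  by rewrite expf_neq0//; lra.
apply: lee_wpmul2r; first by rewrite lee_fin.
have -> : scale d n ^+ d.+1 =
    box_volume (const_mx (scale d n)) (const_mx (2 * scale d n) : 'rV[R]_d.+1).
  rewrite /box_volume; under eq_bigr do rewrite !mxE.
  rewrite prodr_const card_ord; congr (_ ^+ _).
  by rewrite max_r; lra.
apply: le_trans (lebesgue_outer_box_ge _ _) _; apply: le_lebesgue_outer => y yn.
split; last by exists n.
rewrite /eball /= subr0; apply: (@le_lt_trans _ _ (d.+1%:R * (2 * scale d n))).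
  apply: enorm_le_coord => i; have /andP[? ?] := far_cube_coord i yn.
  by rewrite ger0_norm//; lra.
by nra.
Qed.

Lemma far_cubes_measurable d : lebesgue_measurable (far_cubes d).
Proof.
by apply: caratheodory_measurable_bigcup => n; exact: box_measurable.
Qed.

(** Distances are bounded coordinatewise, from above through all coordinates and
from below through the first one; only the absolute value on [R] is then
subject to the triangle inequality. *)
Lemma far_cubes_missed_distance d (x : 'rV[R]_d.+1) (l : R) :
  exists l' : R, l < l' /\ forall y, far_cubes d y -> enorm (x - y) <> l'.
Proof.
have D1 : 1 <= d.+1%:R :> R by rewrite ler1n.
have [n] := scale_unbounded d (Num.max `|l| (enorm x)).
rewrite gt_max => /andP[ln xn]; have s1 := scale_ge1 d n.
exists (3 * d.+1%:R * scale d n); split.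
  by apply: le_lt_trans (ler_norm l) _; nra.
move=> y [m _ ym]; have [mn|nm] := leqP m n.
  have mn' := le_scale d mn.
  apply/eqP; rewrite lt_eqF//.
  have : enorm (x - y) <= d.+1%:R * (enorm x + 2 * scale d n).
    apply: enorm_le_coord => i; have /andP[? ?] := far_cube_coord i ym.
    rewrite !mxE; apply: le_trans (ler_normB _ _) _.
    rewrite lerD ?ler_coord_enorm// ger0_norm; have := scale_ge1 d m; lra.
  by move/le_lt_trans; apply; nra.
have nm' := le_scale d nm; rewrite scaleS in nm'.
apply/eqP; rewrite gt_eqF//.
apply: lt_le_trans (ler_coord_enorm _ ord0).
have /andP[? _] := far_cube_coord ord0 ym.
have := ler_coord_enorm x ord0.
rewrite !mxE distrC => xle.
apply: lt_le_trans (lerB_dist _ _); apply: lt_le_trans (lerB (ler_norm _) xle).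
by nra.
Qed.

End cubes.

Theorem proposition1 (R : realType) (d : nat) (hd : (2 <= d)%N) :
  exists E : set 'rV[R]_d,
    [/\ lebesgue_measurable E,
        (0 < upper_density E)%E &
        forall x : 'rV[R]_d, E x -> forall l : R, 0 < l ->
          exists l' : R, l < l' /\
            forall y : 'rV[R]_d, E y -> enorm (x - y) <> l'].
Proof.
case: d hd => // d _; exists (@far_cubes R d); split.
- exact: far_cubes_measurable.
- exact: far_cubes_density.
- by move=> x _ l _; exact: far_cubes_missed_distance.
Qed.
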